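(* There exist self-full ceers $X$ and $Y$ such that the uniform join $X\oplus Y$ is not self-full.
   Context: A ceer is a computably enumerable equivalence relation on $\omega$. For equivalence relations $R,S$ on $\omega$, $R\leq S$ ($R$ is computably reducible to $S$) if there is a total computable $f$ with $x\,R\,y \Leftrightarrow f(x)\,S\,f(y)$ for all $x,y$; such $f$ is called a reduction of $R$ to $S$. A ceer $R$ is self-full if every computable reduction $f$ of $R$ to $R$ has range intersecting every $R$-equivalence class. The uniform join is $R\oplus S=\{(2x,2y):(x,y)\in R\}\cup\{(2x+1,2y+1):(x,y)\in S\}$. *)

(* Defs.v *)
From Stdlib Require Import RelationClasses.
From mathcomp Require Import all_boot.

Set Implicit Arguments.
Unset Strict Implicit.
Unset Printing Implicit Defensive.

(* Kleene's general recursive functions.  Terms carry no arity: a term acts on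
   argument lists of every length, missing arguments being read as 0.  On lists
   of a fixed length n this yields exactly the n-ary partial recursive
   functions. *)
Inductive recfun : Type :=
| Zero
| Succ
| Proj of nat
| Comp of recfun & seq recfun
| PrimRec of recfun & recfun
| Mu of recfun.

(* [eval c xs y]: the partial function denoted by [c] is defined at [xs], with
   value [y].
   - [PrimRec f g] is the h such that h(0, xs) = f(xs) and
     h(n+1, xs) = g(n, h(n, xs), xs).
   - [Mu f] maps xs to the least y with f(y, xs) = 0; it is defined only if
     f(i, xs) is defined for all i < y. *)
Fixpoint eval (c : recfun) (xs : seq nat) (y : nat) {struct c} : Prop :=
  match c with
  | Zero => y = 0
  | Succ => y = (head 0 xs).+1
  | Proj i => y = nth 0 xs i
  | Comp f gs =>
      exists ys : seq nat,
        (fix evals (gs : seq recfun) (ys : seq nat) : Prop :=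
           match gs, ys with
           | [::], [::] => True
           | g :: gs', y' :: ys' => eval g xs y' /\ evals gs' ys'
           | _, _ => False
           end) gs ys
        /\ eval f ys y
  | PrimRec f g =>
      exists h : nat -> nat,
        [/\ eval f (behead xs) (h 0),
            forall i, i < head 0 xs ->
              eval g [:: i, h i & behead xs] (h i.+1)
          & y = h (head 0 xs)]
  | Mu f =>
      eval f (y :: xs) 0 /\
      forall i, i < y -> exists v, eval f (i :: xs) v.+1
  end.

Definition computable (f : nat -> nat) : Prop :=
  exists c : recfun, forall x, eval c [:: x] (f x).

(* A binary relation is c.e. when it is the domain of a partial recursive
   function of two variables. *)
Definition comp_enum (R : nat -> nat -> Prop) : Prop :=
  exists c : recfun, forall x y, R x y <-> exists v, eval c [:: x; y] v.

Definition ceer (R : nat -> nat -> Prop) : Prop :=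
  Equivalence R /\ comp_enum R.

Definition reduction (R S : nat -> nat -> Prop) (f : nat -> nat) : Prop :=
  computable f /\ forall x y, R x y <-> S (f x) (f y).

Definition self_full (R : nat -> nat -> Prop) : Prop :=
  forall f, reduction R R f -> forall y, exists x, R (f x) y.

Definition uniform_join (R S : nat -> nat -> Prop) (u v : nat) : Prop :=
  (exists x y, [/\ u = 2 * x, v = 2 * y & R x y]) \/
  (exists x y, [/\ u = 2 * x + 1, v = 2 * y + 1 & S x y]).

(* Main.v *)
(** Elements are arranged in chains: (m, j) is the j-th element of chain m, and
    the shift (m, j) |-> (m, j+1) will witness that the join is not self-full.
    Every element is coloured; the elements of colour [true] form the interesting
    part of X, those of colour [false] that of Y, so that the shift moves elements
    back and forth between the two sides.  The only collapses performed are merges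
    of a whole chain m into an older chain n, (m, j) ~ (n, i+j) for all j: they
    commute with the shift, and (0, 0) is never identified with a shifted element.

    Chain m is devoted once and for all to a requirement (phi_e, side b) and to a
    target (n, i) with n < m.  It copies the colours of (n, i+j) and merges into
    its target when this visibly contradicts phi_e being a reduction of side b;
    conflicts between requirements are resolved by finite injury.  If phi_e is
    nevertheless a reduction f, then comparing (n, i) with a fresh copy of it
    shows that f(n, i) ~ (n, i+j) for some j.  Suppose j > 0.  Half of the chains
    are ready to switch: once f(m, 0) has converged to something which cannot
    become (m, 0), such a chain takes the colour opposite to b forever.  Then it
    has only finitely many elements of colour b, so that f, being injective and
    moving elements only forward along the chain, must fix them all: a
    contradiction.  If on the other hand f(m, 0) ~ (m, 0), then merging m into
    (n, i) is a contradiction.  So f is the identity on classes of colour b. *)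

From Stdlib Require Import RelationClasses Classical.
From mathcomp Require Import all_boot zify.
Require Import Defs.

Set Implicit Arguments.
Unset Strict Implicit.
Unset Printing Implicit Defensive.

(** * Closure properties of recursive functions *)

Definition evals (xs : seq nat) :=
  fix evals (gs : seq recfun) (ys : seq nat) : Prop :=
    match gs, ys with
    | [::], [::] => True
    | g :: gs', y' :: ys' => eval g xs y' /\ evals gs' ys'
    | _, _ => False
    end.

(** Predicates fall under the same notion, through the coercion of booleans to 0 and 1. *)
Definition Rec (n : nat) (F : seq nat -> nat) : Prop :=
  exists c, forall xs, size xs = n -> eval c xs (F xs).

Create HintDb rec discriminated.

Lemma rec_ext n F G : F =1 G -> Rec n F -> Rec n G.
Proof. by move=> FG [c Hc]; exists c => xs /Hc; rewrite FG. Qed.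

Lemma rec_ext_size n F G :
  (forall xs, size xs = n -> F xs = G xs) -> Rec n F -> Rec n G.
Proof. by move=> FG [c Hc]; exists c => xs sx; rewrite -FG //; apply: Hc. Qed.

Lemma rec_nth n i : Rec n (fun xs => nth 0 xs i).
Proof. by exists (Proj i). Qed.

Lemma rec_drop n k i : Rec n (fun xs => nth 0 (drop k xs) i).
Proof. by exists (Proj (k + i)) => xs _ /=; rewrite nth_drop. Qed.

Lemma rec_comp n F (Gs : seq (seq nat -> nat)) :
  Rec (size Gs) F -> (forall i, i < size Gs -> Rec n (nth (fun=> 0) Gs i)) ->
  Rec n (fun xs => F [seq G xs | G <- Gs]).
Proof.
move=> [f Hf] HG.
have [gs Hgs]: exists gs, forall xs, size xs = n -> evals xs gs [seq G xs | G <- Gs].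
  elim: Gs HG {Hf} => [|G Gs IH] HG; first by exists [::].
  have [|gs Hgs] := IH; first by move=> i Hi; apply: (HG i.+1).
  have [g Hg] := HG 0 isT.
  by exists (g :: gs) => xs sx; split; [apply: Hg | apply: Hgs].
exists (Comp f gs) => xs sx; exists [seq G xs | G <- Gs]; split; first exact: Hgs.
by apply: Hf; rewrite size_map.
Qed.

Definition Rec1 (f : nat -> nat) := Rec 1 (fun xs => f (nth 0 xs 0)).
Definition Rec2 (f : nat -> nat -> nat) :=
  Rec 2 (fun xs => f (nth 0 xs 0) (nth 0 xs 1)).
Definition Rec3 (f : nat -> nat -> nat -> nat) :=
  Rec 3 (fun xs => f (nth 0 xs 0) (nth 0 xs 1) (nth 0 xs 2)).

Lemma rec_app1 f n a : Rec1 f -> Rec n a -> Rec n (fun xs => f (a xs)).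
Proof. by move=> Hf Ha; apply: (rec_comp (Gs := [:: a]) Hf) => -[]. Qed.

Lemma rec_app2 f n a b :
  Rec2 f -> Rec n a -> Rec n b -> Rec n (fun xs => f (a xs) (b xs)).
Proof. by move=> Hf Ha Hb; apply: (rec_comp (Gs := [:: a; b]) Hf) => -[|[]]. Qed.

Lemma rec_app3 f n a b c :
  Rec3 f -> Rec n a -> Rec n b -> Rec n c ->
  Rec n (fun xs => f (a xs) (b xs) (c xs)).
Proof.
by move=> Hf Ha Hb Hc; apply: (rec_comp (Gs := [:: a; b; c]) Hf) => -[|[|[]]].
Qed.

Lemma rec_succ n a : Rec n a -> Rec n (fun xs => (a xs).+1).
Proof. by apply: rec_app1; exists Succ => -[|? []]. Qed.

Lemma rec_const n k : Rec n (fun=> k).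
Proof.
by elim: k => [|k IH]; [exists Zero | apply: rec_succ].
Qed.

Lemma evals_proj xs n : n <= size xs -> evals xs (mkseq Proj n) (take n xs).
Proof.
rewrite /mkseq => Hn.
have H (k l : nat) : k + l <= size xs -> evals xs [seq Proj i | i <- iota k l] (take l (drop k xs)).
  elim: l k => [|l IH] k Hk; first by rewrite take0.
  rewrite (drop_nth 0) /=; last by lia.
  by split=> //; apply: IH; lia.
by have := H 0 n; rewrite drop0; apply.
Qed.

(** [PrimRec] recurses on the head of its arguments, so the bound is put in front of the whole list;
    the step then finds the parameters in [drop 2 ys]. *)
Lemma rec_nrec n N B (G : nat -> nat -> seq nat -> nat) :
  Rec n N -> Rec n B ->
  Rec n.+2 (fun ys => G (nth 0 ys 0) (nth 0 ys 1) (drop 2 ys)) ->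
  Rec n (fun xs => nat_rect (fun=> nat) (B xs) (fun i h => G i h xs) (N xs)).
Proof.
move=> [N' HN] [b Hb] [g Hg].
exists (Comp (PrimRec b g) (N' :: mkseq Proj n)) => xs sx.
exists (N xs :: xs); split.
  split; first exact: HN.
  by have := @evals_proj xs n; rewrite -sx take_size; apply.
exists (fun k => nat_rect (fun=> nat) (B xs) (fun i h => G i h xs) k); split=> //=.
  exact: Hb.
move=> i _; set h := nat_rect _ _ _ i.
by have := Hg [:: i, h & xs]; rewrite /= sx drop0; apply.
Qed.

Lemma rec_iter n N B (G : nat -> seq nat -> nat) :
  Rec n N -> Rec n B -> Rec n.+2 (fun ys => G (nth 0 ys 1) (drop 2 ys)) ->
  Rec n (fun xs => iter (N xs) (fun z => G z xs) (B xs)).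
Proof.
move=> HN HB HG; apply: rec_ext (rec_nrec (G := fun _ => G) HN HB HG) => xs.
by elim: (N xs) => //= k ->.
Qed.


Lemma rec_subst m n F (s : seq nat) :
  size s = m -> Rec m F -> Rec n (fun ys => F [seq nth 0 ys i | i <- s]).
Proof.
move=> sm HF.
apply: rec_ext (rec_comp (Gs := [seq (fun ys => nth 0 ys i) | i <- s]) _ _).
- by move=> ys; rewrite -map_comp.
- by rewrite size_map sm.
- move=> i; rewrite size_map => Hi; rewrite (nth_map 0) //; exact: rec_nth.
Qed.

Definition ifz (c a b : nat) := nat_rect (fun=> nat) b (fun _ _ => a) c.

Lemma ifz_rec : Rec3 ifz.
Proof.
apply: (rec_nrec (G := fun _ _ xs => nth 0 xs 1)); [exact: rec_nth..|].
exact: rec_drop.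
Qed.

Lemma rec_if n (B : seq nat -> bool) a b :
  Rec n B -> Rec n a -> Rec n b -> Rec n (fun xs => if B xs then a xs else b xs).
Proof.
move=> HB Ha Hb; apply: rec_ext (rec_app3 ifz_rec HB Ha Hb) => xs.
by case: (B xs).
Qed.

Lemma rec_negb n (B : seq nat -> bool) : Rec n B -> Rec n (fun xs => ~~ B xs).
Proof.
move=> HB; apply: rec_ext (rec_if HB (rec_const n 0) (rec_const n 1)) => xs.
by case: (B xs).
Qed.

Lemma rec_andb n (B C : seq nat -> bool) :
  Rec n B -> Rec n C -> Rec n (fun xs => B xs && C xs).
Proof.
move=> HB HC; apply: rec_ext (rec_if HB HC (rec_const n 0)) => xs.
by case: (B xs).
Qed.

Lemma rec_orb n (B C : seq nat -> bool) :
  Rec n B -> Rec n C -> Rec n (fun xs => B xs || C xs).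
Proof.
move=> HB HC; apply: rec_ext (rec_if HB (rec_const n 1) HC) => xs.
by case: (B xs).
Qed.

Lemma rec_ifb n (B C D : seq nat -> bool) :
  Rec n B -> Rec n C -> Rec n D -> Rec n (fun xs => if B xs then C xs else D xs).
Proof.
move=> HB HC HD; apply: rec_ext (rec_if HB HC HD) => xs.
by case: (B xs).
Qed.

Lemma rec_add n a b : Rec n a -> Rec n b -> Rec n (fun xs => a xs + b xs).
Proof.
apply: (@rec_app2 addn); apply: rec_ext (@rec_nrec 2 (fun xs => nth 0 xs 0)
  (fun xs => nth 0 xs 1) (fun _ h _ => h.+1) _ _ _).
- by move=> xs; elim: (nth 0 xs 0) => //= k ->.
- exact: rec_nth.
- exact: rec_nth.
- by apply: rec_succ; exact: rec_nth.
Qed.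

Lemma rec_pred n a : Rec n a -> Rec n (fun xs => (a xs).-1).
Proof.
apply: (@rec_app1 predn); apply: rec_ext (@rec_nrec 1 (fun xs => nth 0 xs 0)
  (fun xs => 0) (fun i _ _ => i) _ _ _).
- by move=> xs; case: (nth 0 xs 0).
- exact: rec_nth.
- exact: rec_const.
- exact: rec_nth.
Qed.

Lemma rec_sub n a b : Rec n a -> Rec n b -> Rec n (fun xs => a xs - b xs).
Proof.
apply: (@rec_app2 subn); apply: rec_ext (@rec_nrec 2 (fun xs => nth 0 xs 1)
  (fun xs => nth 0 xs 0) (fun _ h _ => h.-1) _ _ _).
- by move=> xs; elim: (nth 0 xs 1) => [|k /= ->]; rewrite ?subn0 ?subnS.
- exact: rec_nth.
- exact: rec_nth.
- by apply: rec_pred; exact: rec_nth.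
Qed.

Lemma rec_mul n a b : Rec n a -> Rec n b -> Rec n (fun xs => a xs * b xs).
Proof.
apply: (@rec_app2 muln); apply: rec_ext (@rec_nrec 2 (fun xs => nth 0 xs 0)
  (fun xs => 0) (fun _ h xs => nth 0 xs 1 + h) _ _ _).
- by move=> xs; elim: (nth 0 xs 0) => //= k ->.
- exact: rec_nth.
- exact: rec_const.
- by apply: rec_add; [exact: rec_drop | exact: rec_nth].
Qed.

Lemma rec_expn n a b : Rec n a -> Rec n b -> Rec n (fun xs => a xs ^ b xs).
Proof.
apply: (@rec_app2 expn); apply: rec_ext (@rec_nrec 2 (fun xs => nth 0 xs 1)
  (fun xs => 1) (fun _ h xs => nth 0 xs 0 * h) _ _ _).
- by move=> xs; elim: (nth 0 xs 1) => //= k ->; rewrite expnS.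
- exact: rec_nth.
- exact: rec_const.
- by apply: rec_mul; [exact: rec_drop | exact: rec_nth].
Qed.

Lemma rec_leq n a b : Rec n a -> Rec n b -> Rec n (fun xs => a xs <= b xs).
Proof.
move=> Ha Hb; have H := rec_sub (rec_const n 1) (rec_sub Ha Hb).
by apply: rec_ext H => xs; rewrite -subn_eq0; case: (a xs - b xs).
Qed.

Lemma rec_eqn n a b : Rec n a -> Rec n b -> Rec n (fun xs => a xs == b xs).
Proof.
move=> Ha Hb; apply: rec_ext (rec_andb (rec_leq Ha Hb) (rec_leq Hb Ha)) => xs.
by rewrite eqn_leq.
Qed.

Lemma rec_eqb n (B C : seq nat -> bool) :
  Rec n B -> Rec n C -> Rec n (fun xs => B xs == C xs).
Proof.
move=> Ha Hb; apply: rec_ext (rec_eqn Ha Hb) => xs.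
by case: (B xs); case: (C xs).
Qed.

Lemma rec_find n (P : nat -> seq nat -> bool) N :
  Rec n N -> Rec n.+1 (fun ys => P (nth 0 ys 0) (drop 1 ys)) ->
  Rec n (fun xs => find (fun i => P i xs) (iota 0 (N xs))).
Proof.
move=> HN HP.
(* After [i] steps the accumulator is [find] over [iota 0 i], which equals [i] until a witness
   appears; so [h < i] means that the search is over. *)
apply: rec_ext (rec_nrec (B := fun=> 0)
  (G := fun i h xs => if h < i then h else if P i xs then i else i.+1) HN _ _).
- move=> xs; elim: (N xs) => // k IH.
  rewrite -[in RHS]addn1 iotaD find_cat add0n /= IH size_iota has_find size_iota.
  by case: ltnP => // _; case: (P k xs); rewrite ?addn0 ?addn1.
- exact: rec_const.
- apply: rec_if; first by apply: rec_leq; [apply: rec_succ|]; exact: rec_nth.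
    exact: rec_nth.
  apply: rec_if; [| exact: rec_nth | by apply: rec_succ; exact: rec_nth].
  (* [P] sees the index and the parameters, but not the accumulator at position 1. *)
  have := @rec_subst _ n.+2 _ (0 :: iota 2 n) (congr1 S (size_iota 2 n)) HP.
  apply: rec_ext_size => ys sy; congr (nat_of_bool (P _ _)); rewrite /= drop0.
  rewrite -[RHS](mkseq_nth 0) size_drop sy subSS subSS subn0.
  rewrite (iotaDl 2 0 n) -map_comp.
  by apply: eq_map => i /=; rewrite nth_drop.
Qed.

Lemma rec_has n (P : nat -> seq nat -> bool) N :
  Rec n N -> Rec n.+1 (fun ys => P (nth 0 ys 0) (drop 1 ys)) ->
  Rec n (fun xs => has (fun i => P i xs) (iota 0 (N xs))).
Proof.
move=> HN HP; apply: rec_ext (rec_leq (rec_succ (rec_find HN HP)) HN) => xs.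
by rewrite has_find size_iota.
Qed.

Lemma rec_all n (P : nat -> seq nat -> bool) N :
  Rec n N -> Rec n.+1 (fun ys => P (nth 0 ys 0) (drop 1 ys)) ->
  Rec n (fun xs => all (fun i => P i xs) (iota 0 (N xs))).
Proof.
move=> HN HP; apply: rec_ext (rec_negb (rec_has HN (rec_negb HP))) => xs.
by rewrite -[RHS]/(nat_of_bool _) -[all _ _]negbK -has_predC.
Qed.

Lemma rec_bool n (b : bool) : Rec n (fun=> b).
Proof. exact: rec_const. Qed.

Lemma rec_drop_drop n k l i : Rec n (fun xs => nth 0 (drop k (drop l xs)) i).
Proof.
apply: rec_ext (rec_drop n (k + l) i) => xs.
by rewrite drop_drop.
Qed.

Lemma rec_drop3 n k l m i : Rec n (fun xs => nth 0 (drop k (drop l (drop m xs))) i).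
Proof.
apply: rec_ext (rec_drop n (k + l + m) i) => xs.
by rewrite !drop_drop ?addnA.
Qed.

#[local] Hint Resolve rec_nth rec_drop rec_drop_drop rec_drop3 rec_const rec_bool rec_succ
  rec_pred rec_nrec rec_iter rec_if rec_ifb rec_negb rec_andb rec_orb rec_add
  rec_sub rec_mul rec_expn rec_leq rec_eqn rec_eqb rec_find rec_has rec_all : rec.

(** * Pairing and coded lists *)

Definition pr a b := (2 ^ a * (b + b).+1).-1.
Definition p1 z := logn 2 z.+1.
Definition p2 z := (z.+1 %/ 2 ^ p1 z)./2.

Lemma pr_succ a b : (pr a b).+1 = 2 ^ a * (b + b).+1.
Proof. by rewrite /pr prednK // muln_gt0 expn_gt0. Qed.

Lemma p1_pr a b : p1 (pr a b) = a.
Proof.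
rewrite /p1 pr_succ lognM ?expn_gt0 // pfactorK // logn_coprime ?addn0 //.
by rewrite coprime2n /= addnn odd_double.
Qed.

Lemma p2_pr a b : p2 (pr a b) = b.
Proof.
by rewrite /p2 p1_pr pr_succ mulKn ?expn_gt0 // addnn /= uphalf_double.
Qed.

Lemma pr_p z : pr (p1 z) (p2 z) = z.
Proof.
have /dvdnP[q Hq] := pfactor_dvdnn 2 z.+1.
have oq : odd q.
  have := pfactor_gt0 2 z.+1; have := @pfactorK 2.
  have E : logn 2 z.+1 = logn 2 q + logn 2 z.+1.
    rewrite [in LHS]Hq lognM ?pfactorK ?expn_gt0 //.
    by case: q Hq => //.
  have q0 : 0 < q by case: q Hq {E}.
  have : logn 2 q = 0 by lia.
  by rewrite lognE q0 /= dvdn2; case: (odd q).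
apply: succn_inj; rewrite pr_succ /p2 /p1; move: Hq; move: (logn 2 z.+1) => e ->.
rewrite mulnK ?expn_gt0 // addnn mulnC; congr (_ * _).
by rewrite -[RHS]odd_double_half oq.
Qed.

Lemma pr_ge a b : (a <= pr a b) && (b <= pr a b).
Proof.
have := pr_succ a b; have : a < 2 ^ a by apply: ltn_expl.
by move: (2 ^ a) (pr a b) => u v Hu Hv; nia.
Qed.

Lemma p1_le z : p1 z <= z.
Proof. by rewrite -{2}(pr_p z); case/andP: (pr_ge (p1 z) (p2 z)). Qed.

Lemma p2_le z : p2 z <= z.
Proof. by rewrite -{2}(pr_p z); case/andP: (pr_ge (p1 z) (p2 z)). Qed.

Lemma rec_pr n a b : Rec n a -> Rec n b -> Rec n (fun xs => pr (a xs) (b xs)).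
Proof. move=> Ha Hb; rewrite /pr; auto 20 with rec. Qed.
#[local] Hint Resolve rec_pr : rec.

Lemma find_iota (P : pred nat) n k : k < n -> P k -> (forall i, i < k -> ~~ P i) ->
  find P (iota 0 n) = k.
Proof.
move=> kn Pk Hk; have h : has P (iota 0 n).
  by apply/hasP; exists k; rewrite ?mem_iota.
have := nth_find 0 h; have := before_find 0 (a := P) (s := iota 0 n).
have := h; rewrite has_find size_iota => Hf; rewrite nth_iota // add0n => H Pf.
case: (ltngtP (find P (iota 0 n)) k) => // Hlt.
  by have := Hk _ Hlt; rewrite Pf.
by have := H k Hlt; rewrite nth_iota ?add0n ?Pk //; lia.
Qed.

Lemma rec_p1 n a : Rec n a -> Rec n (fun xs => p1 (a xs)).
Proof.
apply: (@rec_app1 p1).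
have: Rec1 (fun z => find (fun a => has (fun b => pr a b == z) (iota 0 z.+1)) (iota 0 z.+1)).
  by rewrite /Rec1; auto 20 with rec.
apply: rec_ext => xs; move: (nth 0 xs 0) => z; apply: find_iota.
- by rewrite ltnS p1_le.
- by apply/hasP; exists (p2 z); rewrite ?pr_p // mem_iota ltnS p2_le.
- by move=> i Hi; apply/hasPn => b _; apply: contraL Hi => /eqP <-; rewrite p1_pr ltnn.
Qed.

Lemma rec_p2 n a : Rec n a -> Rec n (fun xs => p2 (a xs)).
Proof.
apply: (@rec_app1 p2).
have: Rec1 (fun z => find (fun b => has (fun a => pr a b == z) (iota 0 z.+1)) (iota 0 z.+1)).
  by rewrite /Rec1; auto 20 with rec.
apply: rec_ext => xs; move: (nth 0 xs 0) => z; apply: find_iota.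
- by rewrite ltnS p2_le.
- by apply/hasP; exists (p1 z); rewrite ?pr_p // mem_iota ltnS p1_le.
- by move=> i Hi; apply/hasPn => b _; apply: contraL Hi => /eqP <-; rewrite p2_pr ltnn.
Qed.
#[local] Hint Resolve rec_p1 rec_p2 : rec.

(** The empty list is coded by 0. Both decoders return 0 on it, as [eval] reads missing arguments as
    0. *)
Definition head_code l := p1 l.-1.
Definition tail_code l := p2 l.-1.
Definition cons_code a l := (pr a l).+1.

Lemma rec_head_code n a : Rec n a -> Rec n (fun xs => head_code (a xs)).
Proof. by rewrite /head_code; auto with rec. Qed.
Lemma rec_tail_code n a : Rec n a -> Rec n (fun xs => tail_code (a xs)).
Proof. by rewrite /tail_code; auto with rec. Qed.
Lemma rec_cons_code n a b : Rec n a -> Rec n b -> Rec n (fun xs => cons_code (a xs) (b xs)).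
Proof. by rewrite /cons_code; auto with rec. Qed.
#[local] Hint Resolve rec_head_code rec_tail_code rec_cons_code : rec.

Lemma head_code_cons a l : head_code (cons_code a l) = a. Proof. exact: p1_pr. Qed.
Lemma tail_code_cons a l : tail_code (cons_code a l) = l. Proof. exact: p2_pr. Qed.
Lemma head_code0 : head_code 0 = 0. Proof. exact: (p1_pr 0 0). Qed.
Lemma tail_code0 : tail_code 0 = 0. Proof. exact: (p2_pr 0 0). Qed.

Opaque pr p1 p2.

Definition mem_code l s :=
  has (fun k => (0 < iter k tail_code l) && (head_code (iter k tail_code l) == s)) (iota 0 l).

Lemma rec_mem_code n a b : Rec n a -> Rec n b -> Rec n (fun xs => mem_code (a xs) (b xs)).
Proof. apply: (@rec_app2 mem_code); rewrite /Rec2 /mem_code; auto 20 with rec. Qed.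
#[local] Hint Resolve rec_mem_code : rec.

Lemma iter_tail_code k l : l <= k -> iter k tail_code l = 0.
Proof.
have H i : iter i tail_code l <= l - i.
  elim: i => [|i IH]; first by rewrite subn0.
  rewrite iterS; have : tail_code (iter i tail_code l) <= (iter i tail_code l).-1 by exact: p2_le.
  by move: (iter i tail_code l) IH => v; lia.
by move=> Hl; apply/eqP; rewrite -leqn0 -(eqP Hl).
Qed.

Lemma mem_codeP l s : reflect
  (exists2 k, 0 < iter k tail_code l & head_code (iter k tail_code l) = s) (mem_code l s).
Proof.
apply: (iffP hasP) => [[k _ /andP[H1 /eqP H2]]|[k H1 H2]]; first by exists k.
exists k; last by rewrite H1 H2 eqxx.
by rewrite mem_iota /= add0n ltnNge; apply: contraL H1 => /iter_tail_code ->.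
Qed.

Lemma mem_code_cons a l s : mem_code (cons_code a l) s = (a == s) || mem_code l s.
Proof.
apply/mem_codeP/orP => [[[|k]]|[/eqP <-|/mem_codeP[k H1 H2]]].
- by rewrite /= head_code_cons => _ ->; left.
- rewrite iterSr tail_code_cons => H1 H2; right; apply/mem_codeP.
  by exists k.
- by exists 0; rewrite //= head_code_cons.
- by exists k.+1; rewrite iterSr tail_code_cons.
Qed.


(** * A universal function *)

(* The fact "the function coded by [e] maps the argument list coded by [x] to
   [y]".  A code is a pair of a tag and an argument.  Tags: 0 Zero and the empty
   list of functions, 1 Succ, 2 Proj, 3 Comp, 4 a nonempty list of functions
   (whose value is the code of a list), 5 PrimRec, 6 Mu, 7 the search of Mu,
   started at the head of [x]. *)
Definition fact e x y := pr e (pr x y).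
Definition fe k := p1 k.
Definition fx k := p1 (p2 k).
Definition fy k := p2 (p2 k).

Lemma fe_fact e x y : fe (fact e x y) = e. Proof. exact: p1_pr. Qed.
Lemma fx_fact e x y : fx (fact e x y) = x.
Proof. by rewrite /fx p2_pr p1_pr. Qed.
Lemma fy_fact e x y : fy (fact e x y) = y.
Proof. by rewrite /fy p2_pr p2_pr. Qed.
Lemma fact_f k : k = fact (fe k) (fx k) (fy k).
Proof. by rewrite /fact /fe /fx /fy !pr_p. Qed.

Definition axiom_at t a x y :=
  [|| (t == 0) && (y == 0), (t == 1) && (y == (head_code x).+1)
    | (t == 2) && (y == head_code (iter a tail_code x))].

(** [p] and [q] are the premises. A recursion step takes the previous value from [q] and applies the
    step function in [p]; a search step tests the current candidate in [p] and continues the search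
    in [q]. *)
Definition rule_at t a x y p q :=
  if t == 3 then
    [&& fe q == p2 a, fx q == x, fe p == p1 a, fx p == fy q & fy p == y]
  else if t == 4 then
    [&& 0 < y, p == fact (p1 a) x (head_code y) & q == fact (p2 a) x (tail_code y)]
  else if t == 5 then
    if head_code x == 0 then p == fact (p1 a) (tail_code x) y
    else (q == fact (pr 5 a) (cons_code (head_code x).-1 (tail_code x)) (fy q)) &&
         (p == fact (p2 a) (cons_code (head_code x).-1 (cons_code (fy q) (tail_code x))) y)
  else if t == 6 then p == fact (pr 7 a) (cons_code 0 x) y
  else if t == 7 then
    [&& fe p == a, fx p == x &
     if fy p == 0 then y == head_code x
     else q == fact (pr 7 a) (cons_code (head_code x).+1 (tail_code x)) y]
  else false.

Definition is_axiom k := axiom_at (p1 (fe k)) (p2 (fe k)) (fx k) (fy k).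
Definition is_rule k p q := rule_at (p1 (fe k)) (p2 (fe k)) (fx k) (fy k) p q.

(* At stage [s] the candidate fact is [p1 s], so that every fact is considered at
   arbitrarily late stages; [L] lists the facts derived before. *)
Definition derive_step L s :=
  is_axiom (p1 s) ||
  has (fun p => mem_code L p && has (fun q => mem_code L q && is_rule (p1 s) p q) (iota 0 s))
      (iota 0 s).

Definition derived s :=
  nat_rect (fun=> nat) 0 (fun i L => if derive_step L i then cons_code (p1 i) L else L) s.

Lemma rec_derived n a : Rec n a -> Rec n (fun xs => derived (a xs)).
Proof.
apply: (@rec_app1 derived).
rewrite /Rec1 /derived /derive_step /is_axiom /is_rule /axiom_at /rule_at
  /fact /fe /fx /fy.
auto 50 with rec.
Qed.
#[local] Hint Resolve rec_derived : rec.

Definition known s k := mem_code (derived s) k.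

Lemma known_mono s t k : s <= t -> known s k -> known t k.
Proof.
move=> /subnKC <-; elim: (t - s) => [|d IH]; rewrite ?addn0 // => /IH.
rewrite addnS /known /=; case: ifP => // _; by rewrite mem_code_cons orbC => ->.
Qed.

Lemma known_inv s k : known s k ->
  exists2 t, t < s & is_axiom k \/ exists p q, [/\ known t p, known t q & is_rule k p q].
Proof.
elim: s => // s IH; rewrite {1}/known /=.
have H : known s k -> exists2 t, t < s.+1 &
    is_axiom k \/ exists p q, [/\ known t p, known t q & is_rule k p q].
  by move=> /IH[t Ht Hk]; exists t => //; lia.
case: ifP => [|_]; last exact: H.
rewrite mem_code_cons => Hst /orP[/eqP E|]; last exact: H.
subst k; exists s => //; case/orP: Hst => [|/hasP[p _ /andP[Hp /hasP[q _ /andP[Hq R]]]]].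
  by left.
by right; exists p, q.
Qed.

Lemma known_lt s k : known s k -> k < s.
Proof.
elim: s => // s IH; rewrite {1}/known /=.
case: ifP => _; last by move=> /IH; lia.
rewrite mem_code_cons => /orP[/eqP <-|/IH]; last by lia.
by rewrite ltnS p1_le.
Qed.

Definition derivable e x y := exists s, known s (fact e x y).

Lemma derivable_ax t a x y : axiom_at t a x y -> derivable (pr t a) x y.
Proof.
move=> H; exists (pr (fact (pr t a) x y) 0).+1; rewrite /known /=.
rewrite /derive_step p1_pr /is_axiom fe_fact fx_fact fy_fact p1_pr p2_pr H /=.
by rewrite mem_code_cons eqxx.
Qed.

Lemma derivable_rule t a x y e1 x1 y1 e2 x2 y2 :
  derivable e1 x1 y1 -> derivable e2 x2 y2 ->
  rule_at t a x y (fact e1 x1 y1) (fact e2 x2 y2) -> derivable (pr t a) x y.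
Proof.
move=> [s1 H1] [s2 H2] R; set k := fact (pr t a) x y.
(* The stage [pr k (s1 + s2)] considers [k] and is late enough for both premises to be known. *)
have /andP[_ Hs] := pr_ge k (s1 + s2); set s := pr k (s1 + s2) in Hs.
have K1 : known s (fact e1 x1 y1) by apply: known_mono H1; lia.
have K2 : known s (fact e2 x2 y2) by apply: known_mono H2; lia.
exists s.+1; rewrite /known /=.
have -> : derive_step (derived s) s.
  apply/orP; right; apply/hasP; exists (fact e1 x1 y1).
    by rewrite mem_iota /= add0n known_lt.
  rewrite -/(known _ _) K1 /=; apply/hasP; exists (fact e2 x2 y2).
    by rewrite mem_iota /= add0n known_lt.
  rewrite -/(known _ _) K2 /= /is_rule /s p1_pr /k fe_fact fx_fact fy_fact.
  by rewrite p1_pr p2_pr.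
by rewrite /s p1_pr mem_code_cons eqxx.
Qed.

Lemma derivable_rule1 t a x y e1 x1 y1 :
  derivable e1 x1 y1 ->
  (forall q, rule_at t a x y (fact e1 x1 y1) q) -> derivable (pr t a) x y.
Proof. by move=> H R; exact: (derivable_rule H H (R _)). Qed.

Lemma known_inv_at s t a x y : known s (fact (pr t a) x y) ->
  exists2 s', s' < s & axiom_at t a x y \/
    exists p q, [/\ known s' p, known s' q & rule_at t a x y p q].
Proof.
move=> /known_inv[s' Hs]; rewrite /is_axiom /is_rule fe_fact fx_fact fy_fact.
by rewrite p1_pr p2_pr; exists s'.
Qed.

Definition code : seq nat -> nat := foldr cons_code 0.

Lemma head_code_code xs : head_code (code xs) = head 0 xs.
Proof. by case: xs => [|x xs]; [exact: head_code0 | exact: head_code_cons]. Qed.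

Lemma tail_code_code xs : tail_code (code xs) = code (behead xs).
Proof. by case: xs => [|x xs]; [exact: tail_code0 | exact: tail_code_cons]. Qed.

Lemma nth_code xs i : head_code (iter i tail_code (code xs)) = nth 0 xs i.
Proof.
elim: i xs => [|i IH] xs; first by rewrite head_code_code nth0.
by rewrite iterSr tail_code_code IH nth_behead.
Qed.

Fixpoint enc (c : recfun) : nat :=
  match c with
  | Zero => pr 0 0
  | Succ => pr 1 0
  | Proj i => pr 2 i
  | Comp f gs => pr 3 (pr (enc f) (foldr (fun g e => pr 4 (pr (enc g) e)) (pr 0 0) gs))
  | PrimRec f g => pr 5 (pr (enc f) (enc g))
  | Mu f => pr 6 (enc f)
  end.
Definition encs gs := foldr (fun g e => pr 4 (pr (enc g) e)) (pr 0 0) gs.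

Section RecfunInd.
Variable P : recfun -> Prop.
Hypotheses (P0 : P Zero) (PS : P Succ) (Pp : forall i, P (Proj i)).
Hypothesis Pc : forall f gs, P f -> (forall i, i < size gs -> P (nth Zero gs i)) -> P (Comp f gs).
Hypothesis Pr : forall f g, P f -> P g -> P (PrimRec f g).
Hypothesis Pm : forall f, P f -> P (Mu f).

Fixpoint recfun_nested_ind (c : recfun) : P c :=
  match c with
  | Zero => P0
  | Succ => PS
  | Proj i => Pp i
  | Comp f gs => Pc (recfun_nested_ind f)
      ((fix all (gs : seq recfun) : forall i, i < size gs -> P (nth Zero gs i) :=
        match gs with
        | [::] => fun i (h : i < 0) => False_ind _ (Bool.diff_false_true h)
        | g :: gs' => fun i =>
            match i with
            | 0 => fun _ => recfun_nested_ind g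
            | j.+1 => fun h => all gs' j h
            end
        end) gs)
  | PrimRec f g => Pr (recfun_nested_ind f) (recfun_nested_ind g)
  | Mu f => Pm (recfun_nested_ind f)
  end.
End RecfunInd.


(** Tags 5 and 7 refer back to the same code, so the induction on the term is completed by one on
    the counter for primitive recursion and by one on the stage of derivation for searches. *)
Lemma known_sound c s xs y : known s (fact (enc c) (code xs) y) -> eval c xs y.
Proof.
elim/recfun_nested_ind: c s xs y => [||i|f gs IHf IHgs|f g IHf IHg|f IHf] s xs y /=.
- by case/known_inv_at=> s' _ [/or3P[]//|[p [q [_ _ ]]]] //= /eqP.
- case/known_inv_at=> s' _ [/or3P[]//=|[p [q [_ _ ]]]] //.
  by rewrite head_code_code => /eqP.
- case/known_inv_at=> s' _ [/or3P[]//=|[p [q [_ _ ]]]] //.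
  by rewrite nth_code => /eqP.
- have Hgs s' ys : known s' (fact (encs gs) (code xs) ys) ->
      exists2 zs, ys = code zs & evals xs gs zs.
    elim: gs IHgs s' ys {IHf} => [|g gs IH] IHgs s' ys /=.
      case/known_inv_at=> s'' _ [/or3P[]//=|[p [q [_ _ ]]]] // /eqP ->.
      by exists [::].
    case/known_inv_at=> s'' _ [/or3P[]//=|[p [q [Kp Kq ]]]] /=.
    rewrite /rule_at /= p1_pr p2_pr => /and3P[y0 /eqP Ep /eqP Eq].
    rewrite Ep in Kp; rewrite Eq in Kq.
    have [|zs Ezs Hzs] := IH _ _ _ Kq; first by move=> i Hi; apply: (IHgs i.+1).
    exists (head_code ys :: zs); last by split=> //; apply: (IHgs 0 isT _ _ _ Kp).
    by rewrite /= -Ezs /cons_code /head_code /tail_code pr_p prednK.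
  case/known_inv_at=> s'' _ [/or3P[]//=|[p [q [Kp Kq ]]]] /=.
  rewrite /rule_at /= p1_pr p2_pr => /and5P[/eqP q1 /eqP q2 /eqP r1 /eqP r2 /eqP r3].
  rewrite (fact_f q) q1 q2 in Kq; rewrite (fact_f p) r1 r2 r3 in Kp.
  have [zs Ez Hz] := Hgs _ _ Kq; exists zs; split=> //.
  by rewrite Ez in Kp; apply: IHf Kp.
- set e := pr 5 _ => Hk.
  have H : forall n s' x' y', head_code x' = n -> tail_code x' = code (behead xs) ->
    known s' (fact e x' y') ->
    exists h : nat -> nat, [/\ eval f (behead xs) (h 0),
      forall i, i < n -> eval g [:: i, h i & behead xs] (h i.+1) & y' = h n].
    elim=> [|n IHn] s' x' y' Hn Ht.
      case/known_inv_at=> s'' _ [/or3P[]//=|[p [q [Kp Kq ]]]] /=.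
      rewrite /rule_at /= p1_pr p2_pr Hn Ht eqxx => /eqP Ep.
      by exists (fun=> y'); split=> //; apply: (IHf s''); rewrite -Ep.
    case/known_inv_at=> s'' _ [/or3P[]//=|[p [q [Kp Kq ]]]] /=.
    rewrite /rule_at /= p1_pr p2_pr Hn Ht /= => /andP[/eqP Eq /eqP Ep].
    rewrite Eq in Kq; rewrite Ep in Kp.
    have [||h [h0 hS hn]] := IHn _ _ _ _ _ Kq; rewrite ?head_code_cons ?tail_code_cons //.
    exists (fun i => if i == n.+1 then y' else h i); split=> //; last by rewrite eqxx.
    move=> i; rewrite ltnS leq_eqVlt => /orP[/eqP ->|Hi].
      rewrite /= eqxx ltn_eqF // -hn.
      exact: (IHg s'').
    rewrite /= eqSS !ltn_eqF //; last by lia.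
    exact: hS.
  have [h [h0 hS hn]] := H _ _ _ _ (head_code_code xs) (tail_code_code xs) Hk.
  by exists h.
- case/known_inv_at=> s' _ [/or3P[]//=|[p [q [Kp _ ]]]] /=.
  rewrite /rule_at /= => /eqP Ep; rewrite Ep in Kp.
  suff H : forall s' i, known s' (fact (pr 7 (enc f)) (cons_code i (code xs)) y) ->
    [/\ i <= y, eval f (y :: xs) 0 &
      forall j, i <= j < y -> exists v, eval f (j :: xs) v.+1].
    by have [_ H0 HS] := H _ _ Kp; split=> // i Hi; apply: HS.
  elim/ltn_ind=> {s' q Kp Ep p s} s IHs i.
  case/known_inv_at=> s' Hs [/or3P[]//=|[p [q [Kp Kq ]]]] /=.
  rewrite /rule_at /= head_code_cons tail_code_cons => /and3P[/eqP E1 /eqP E2].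
  rewrite (fact_f p) E1 E2 in Kp.
  have Ev := IHf _ (i :: xs) _ Kp; case: eqP => [E0 /eqP ->|].
    by rewrite -E0; split=> // j; lia.
  case: (fy p) Ev => // v Ev _ /eqP Eq; rewrite Eq in Kq.
  have [Hi H0 HS] := IHs _ Hs _ Kq; split=> // [|j Hj]; first by lia.
  case: (ltngtP i j) => [Hij|Hij|<-]; [apply: HS; lia | lia | by exists v].
Qed.

Lemma known_complete c xs y : eval c xs y -> derivable (enc c) (code xs) y.
Proof.
elim/recfun_nested_ind: c xs y => [||i|f gs IHf IHgs|f g IHf IHg|f IHf] xs y /=.
- by move=> ->; apply: derivable_ax.
- by move=> ->; apply: derivable_ax; rewrite /axiom_at /= head_code_code eqxx.
- by move=> ->; apply: derivable_ax; rewrite /axiom_at /= nth_code eqxx.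
- move=> [zs []]; rewrite -/(evals xs gs zs) => Hzs /IHf Hf.
  have Hg : derivable (encs gs) (code xs) (code zs).
    elim: gs zs IHgs Hzs {Hf IHf} => [|g gs IH] [|z zs] IHgs //= H.
      exact: derivable_ax.
    case: H => Hz Hzs.
    apply: (derivable_rule (IHgs 0 isT _ _ Hz) (IH zs _ Hzs)).
      by move=> i Hi; apply: (IHgs i.+1).
    by rewrite /rule_at /= p1_pr p2_pr head_code_cons tail_code_cons !eqxx.
  apply: derivable_rule Hf Hg _.
  by rewrite /rule_at /= p1_pr p2_pr !fe_fact !fx_fact !fy_fact !eqxx.
- move=> [h [/IHf h0 hS ->]].
  have H n : n <= head 0 xs -> forall x, head_code x = n -> tail_code x = code (behead xs) ->
    derivable (pr 5 (pr (enc f) (enc g))) x (h n).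
    elim: n => [|n IHn] Hn x hx tx.
      by apply: derivable_rule1 h0 _ => q; rewrite /rule_at /= hx tx p1_pr eqxx.
    have Hq := IHn (ltnW Hn) (cons_code n (code (behead xs)))
      (head_code_cons _ _) (tail_code_cons _ _).
    have Hp := IHg _ _ (hS n Hn).
    apply: derivable_rule Hp Hq _.
    by rewrite /rule_at /= hx tx p2_pr fy_fact !eqxx.
  by apply: (H (head 0 xs)); rewrite ?head_code_code ?tail_code_code.
- move=> [/IHf H0 HS].
  (* The search is rebuilt backwards from its result [y]; [d] is the distance from the starting
     point to [y]. *)
  have H d : d <= y -> derivable (pr 7 (enc f)) (cons_code (y - d) (code xs)) y.
    elim: d => [|d IHd] Hd.
      rewrite subn0; apply: derivable_rule1 H0 _ => q.
      by rewrite /rule_at /= !(fe_fact, fx_fact, fy_fact) head_code_cons !eqxx.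
    have [|v /IHf Hp] := HS (y - d.+1); first by lia.
    apply: derivable_rule Hp (IHd (ltnW Hd)) _.
    rewrite /rule_at /= !(fe_fact, fx_fact, fy_fact) head_code_cons tail_code_cons !eqxx /=.
    by rewrite subnSK.
  have := H y (leqnn y); rewrite subnn => Hy.
  by apply: derivable_rule1 Hy _ => q; rewrite /rule_at /= eqxx.
Qed.

Lemma eval_inj c xs y z : eval c xs y -> eval c xs z -> y = z.
Proof.
elim/recfun_nested_ind: c xs y z => [||i|f gs IHf IHgs|f g IHf IHg|f IHf] xs y z /=.
- by move=> -> ->.
- by move=> -> ->.
- by move=> -> ->.
- move=> [us [Hu Eu]] [vs [Hv Ev]]; apply: (IHf us) => //.
  suff -> : us = vs by [].
  move: Hu Hv; rewrite -!/(evals xs gs _).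
  elim: gs us vs IHgs {IHf Eu Ev} => [|g gs IH] [|u us] [|v vs] // IHgs [Hu Hus] [Hv Hvs].
  congr cons; first exact: (IHgs 0 isT xs).
  by apply: IH => // i Hi; apply: (IHgs i.+1).
- move=> [h [h0 hS ->]] [k [k0 kS ->]].
  have: forall n, n <= head 0 xs -> h n = k n; last by apply.
  elim=> [|n IHn] Hn; first exact: IHf h0 k0.
  by have := hS n Hn; rewrite IHn 1?ltnW // => H; apply: IHg H (kS n Hn).
- move=> [y0 Hy] [z0 Hz]; case: (ltngtP y z) => // H.
    by have [v] := Hz y H => /(IHf _ _ _ y0).
  by have [v] := Hy z H => /(IHf _ _ _ z0).
Qed.

(* The value of the [e]-th function at [x], plus 1, if found by stage [s];
   freezing the first value found makes this single-valued for every [e],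
   including those that encode no term. *)
Definition ev e x s :=
  nat_rect (fun=> nat) 0 (fun i r => if 0 < r then r else
    if find (fun y => known i (fact e (cons_code x 0) y)) (iota 0 i) < i then
      (find (fun y => known i (fact e (cons_code x 0) y)) (iota 0 i)).+1 else 0) s.

Lemma rec_ev n a b c : Rec n a -> Rec n b -> Rec n c ->
  Rec n (fun xs => ev (a xs) (b xs) (c xs)).
Proof.
apply: (@rec_app3 ev); rewrite /Rec3 /ev /known /fact; auto 50 with rec.
Qed.
#[local] Hint Resolve rec_ev : rec.

Lemma ev_mono e x s t y : s <= t -> ev e x s = y.+1 -> ev e x t = y.+1.
Proof.
move=> /subnKC <- H; elim: (t - s) => [|d IH]; rewrite ?addn0 // addnS /=.
by rewrite -/(ev _ _ _) IH.
Qed.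

Lemma ev_known e x s y : ev e x s = y.+1 -> exists t, known t (fact e (cons_code x 0) y).
Proof.
elim: s => //= s IH; rewrite -/(ev _ _ _).
case: ifP => _ //; case: ifP => // Hf [<-]; exists s.
have := @nth_find _ 0 (fun y => known s (fact e (cons_code x 0) y)) (iota 0 s).
by rewrite has_find size_iota nth_iota // => /(_ Hf).
Qed.

Lemma computable_index f : computable f ->
  exists e, forall x, exists s, ev e x s = (f x).+1.
Proof.
move=> [c Hc]; exists (enc c) => x.
have [s Hs] := known_complete (Hc x).
have Hfx t y : ev (enc c) x t = y.+1 -> y = f x.
  by move=> /ev_known[u /(@known_sound c u [:: x]) Hu]; apply: eval_inj Hu (Hc x).
have : 0 < ev (enc c) x s.+1.
  rewrite /= -/(ev _ _ _); case: ifP => // _.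
  have -> // : find (fun y => known s (fact (enc c) (cons_code x 0) y)) (iota 0 s) < s.
  (* The value is bounded by the code of its fact, which is below the stage at which it is known; so
     the bounded search in [ev] finds it. *)
  rewrite -[ltnRHS](size_iota 0) -has_find; apply/hasP; exists (f x) => //.
  rewrite mem_iota /= add0n; apply: leq_ltn_trans (known_lt Hs).
  by case/andP: (pr_ge (enc c) (pr (code [:: x]) (f x))) (pr_ge (code [:: x]) (f x))
    => _ + /andP[_]; rewrite /fact; lia.
by case E : (ev _ _ _) => [//|y] _; exists s.+1; rewrite E (Hfx _ _ E).
Qed.

Lemma rec_computable f : Rec1 f -> computable f.
Proof. by move=> [c Hc]; exists c => x; apply: (Hc [:: x]). Qed.

(** [Mu] searches for a stage [s]; it looks for a zero, hence the negation of [P]. *)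
Lemma rec_comp_enum (R : nat -> nat -> Prop) (P : nat -> nat -> nat -> bool) :
  Rec3 P -> (forall x y, R x y <-> exists s, P s x y) -> comp_enum R.
Proof.
move=> HP HR; have HN : Rec3 (fun s x y => ~~ P s x y).
  exact: rec_negb HP.
case: HN => c Hc; exists (Mu c) => x y; rewrite HR; split=> [[s Hs]|[s [/= Hs _]]].
  have ex : exists s, P s x y by exists s.
  case: (ex_minnP ex) => m Hm min_m; exists m; split.
    by have := Hc [:: m; x; y] erefl; rewrite /= Hm.
  move=> i Hi; exists 0; have := Hc [:: i; x; y] erefl; rewrite /=.
  by case E : (P i x y) => //; have := min_m i E; lia.
exists s; have := eval_inj Hs (Hc [:: s; x; y] erefl).
by rewrite /=; case: (P s x y).
Qed.


Opaque ev.

Lemma mem_code_lt l s : mem_code l s -> s < l.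
Proof.
move=> /mem_codeP[k H1 <-].
have: iter k tail_code l <= l.
  elim: k {H1} => //= k; apply: leq_trans.
  by apply: leq_trans (p2_le _) (leq_pred _).
apply: leq_trans; rewrite /head_code.
by case: (iter k tail_code l) H1 => // u _; rewrite ltnS p1_le.
Qed.

(** * Iterating a map that lowers the chain index *)

Section Stabilize.
Variable g : nat -> nat.
Hypothesis g_lt : forall x, g x = x \/ p1 (g x) < p1 x.

Definition limit_of x := iter (p1 x) g x.

Lemma limit_fix_ge n x : p1 x <= n -> g (iter n g x) = iter n g x.
Proof.
elim: n x => [|n IH] x Hx /=; first by case: (g_lt x) => //; lia.
case: (g_lt x) => [E|lt]; first by rewrite (iter_fix n E) !E.
by rewrite -iterS iterSr IH //; lia.
Qed.

Lemma limit_fix x : g (limit_of x) = limit_of x.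
Proof. exact: limit_fix_ge. Qed.

Lemma limit_ge n x : p1 x <= n -> iter n g x = limit_of x.
Proof.
by move=> /subnK <-; rewrite iterD iter_fix // limit_fix.
Qed.

Lemma limit_step x : limit_of (g x) = limit_of x.
Proof.
have H : p1 (g x) <= p1 x by case: (g_lt x) => [->|/ltnW].
by rewrite -(limit_ge H) -iterSr iterS limit_fix.
Qed.

Lemma limit_id x : g x = x -> limit_of x = x.
Proof. by move=> E; rewrite /limit_of iter_fix. Qed.
End Stabilize.

(** * Chains *)

(* The static data of chain [m]: its requirement (a function index and a side), its
   target [(target m, offset m)], and whether it may switch colours.  A last,
   unused component provides infinitely many chains with the same data. *)
Definition req m := p1 m.-1.
Definition target m := p1 (p2 m.-1).
Definition offset m := p1 (p2 (p2 m.-1)).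
Definition switching m := p1 (p2 (p2 (p2 m.-1))) == 1.
Definition fun_index m := p1 (req m).
Definition side m := p2 (req m) == 1.

Definition mk_chain e (b : bool) n i (t : bool) k :=
  (pr (pr e b) (pr n (pr i (pr t k)))).+1.

Lemma mk_chainE e b n i t k (m := mk_chain e b n i t k) :
  [/\ req m = pr e b, fun_index m = e, side m = b &
   [/\ target m = n, offset m = i & switching m = t]].
Proof.
rewrite /fun_index /side /req /target /offset /switching /m /mk_chain succnK !(p1_pr, p2_pr).
by move=> {m}; case: b; case: t.
Qed.

(** A large padding [k] yields chains with prescribed data beyond any given bound. *)
Lemma mk_chain_gt e b n i t k : k < mk_chain e b n i t k.
Proof.
have [_ H1] := andP (pr_ge (pr e b) (pr n (pr i (pr t k)))).
have [_ H2] := andP (pr_ge n (pr i (pr t k))).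
have [_ H3] := andP (pr_ge i (pr t k)).
have [_ H4] := andP (pr_ge t k).
by rewrite /mk_chain; lia.
Qed.

Lemma target_lt m : 0 < m -> target m < m.
Proof.
by case: m => // m _; rewrite ltnS; apply: leq_trans (p1_le _) (p2_le _).
Qed.

(* [parent] ignores whether the chain has actually been merged. *)
Definition parent x := if p1 x == 0 then x else pr (target (p1 x)) (offset (p1 x) + p2 x).

Lemma parent_lt x : 0 < p1 x -> p1 (parent x) < p1 x.
Proof. by move=> H; rewrite {1}/parent eqn0Ngt H /= p1_pr target_lt. Qed.

Lemma parent_le x : p1 (parent x) <= p1 x.
Proof. by case: (posnP (p1 x)) => [E|/parent_lt/ltnW //]; rewrite /parent E /= E. Qed.

Lemma parent_pr m j : 0 < m -> parent (pr m j) = pr (target m) (offset m + j).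
Proof. by move=> H; rewrite /parent p1_pr p2_pr eqn0Ngt H. Qed.

Definition shift k x := pr (p1 x) (p2 x + k).

Lemma p1_shift k x : p1 (shift k x) = p1 x. Proof. exact: p1_pr. Qed.
Lemma p2_shift k x : p2 (shift k x) = p2 x + k. Proof. exact: p2_pr. Qed.

Lemma shift_pr k m j : shift k (pr m j) = pr m (j + k).
Proof. by rewrite /shift p1_pr p2_pr. Qed.

Lemma shift_inj k x y : shift k x = shift k y -> x = y.
Proof.
move=> E; rewrite -(pr_p x) -(pr_p y) -(p1_shift k x) -(p1_shift k y) E.
by congr pr; apply/(@addIn k); rewrite -!p2_shift E.
Qed.

Lemma shift_injl k l x : shift k x = shift l x -> k = l.
Proof. by move=> E; apply/(@addnI (p2 x)); rewrite -!p2_shift E. Qed.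

Lemma parent_shift k x : parent (shift k x) = shift k (parent x).
Proof. by rewrite /parent p1_shift p2_shift; case: eqP => // _; rewrite shift_pr addnA. Qed.

Lemma iter_parent_le k x : p1 (iter k parent x) <= p1 x.
Proof. by elim: k => //= k; apply: leq_trans; apply: parent_le. Qed.

(** Chain indices strictly decrease along a parent path until chain 0, so each positive chain is met
    at most once. *)
Lemma parent_path_inj k l x :
  0 < p1 (iter k parent x) -> p1 (iter k parent x) = p1 (iter l parent x) -> k = l.
Proof.
have H y d : 0 < p1 y -> p1 (iter d parent y) = p1 y -> d = 0.
  case: d => // d y0; rewrite iterSr => E.
  by have := iter_parent_le d (parent y); rewrite E leqNgt parent_lt.
move=> k0 E; case: (leqP k l) => Hkl.
  have := H (iter k parent x) (l - k) k0; rewrite -iterD subnK // => /(_ (esym E)); lia.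
have := H (iter l parent x) (k - l); rewrite -iterD subnK ?(ltnW Hkl) // -E.
by move=> /(_ k0 erefl); lia.
Qed.

Definition reach x y := has (fun k => iter k parent x == y) (iota 0 (p1 x).+1).

Lemma reachP x m j : 0 < m ->
  reflect (exists k, iter k parent x = pr m j) (reach x (pr m j)).
Proof.
move=> m0; apply: (iffP hasP) => [[k _ /eqP H]|[k H]]; first by exists k.
exists k; last exact/eqP.
have {m0 H}: 0 < p1 (iter k parent x) by rewrite H p1_pr.
rewrite mem_iota /= add0n ltnS.
elim: k x => // k IH x; rewrite iterSr => H; have := IH _ H.
have : 0 < p1 x by apply: leq_trans H _; rewrite -iterSr iter_parent_le.
by move=> /parent_lt; lia.
Qed.

(** * Colours *)

(* [reach] only uses [parent], so that a value which does not reach [(m, 0)] will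
   never be identified with it, whatever merges happen later. *)
Definition switched m j :=
  [&& switching m, 0 < ev (fun_index m) (pr m 0) j &
      ~~ reach (ev (fun_index m) (pr m 0) j).-1 (pr m 0)].

(** The position of an element doubles as the time allowed to the computation in [switched]; this
    keeps colours decidable. *)
Definition colour_step x := if (p1 x == 0) || switched (p1 x) (p2 x) then x else parent x.

(** The walk stops in chain 0, coloured [true], or at a switched element, coloured opposite to the
    side of its chain. *)
Definition colour x :=
  (p1 (iter (p1 x) colour_step x) == 0) || ~~ side (p1 (iter (p1 x) colour_step x)).

Lemma colour_step_lt x : colour_step x = x \/ p1 (colour_step x) < p1 x.
Proof.
rewrite /colour_step; case: posnP => [|x0] /=; first by left.
by case: ifP => _; [left | right; apply: parent_lt].
Qed.

Lemma colour_chain0 x : p1 x = 0 -> colour x.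
Proof. by move=> E; rewrite /colour E /= E. Qed.

Lemma colour_switched m j : 0 < m -> switched m j -> colour (pr m j) = ~~ side m.
Proof.
move=> m0 Hs; have E : colour_step (pr m j) = pr m j.
  by rewrite /colour_step p1_pr p2_pr Hs orbT.
by rewrite /colour -/(limit_of colour_step _) (limit_id E) p1_pr eqn0Ngt m0.
Qed.

Lemma colour_parent m j : 0 < m -> ~~ switched m j ->
  colour (pr m j) = colour (pr (target m) (offset m + j)).
Proof.
move=> m0 Hs; have E : colour_step (pr m j) = pr (target m) (offset m + j).
  by rewrite /colour_step p1_pr p2_pr eqn0Ngt m0 (negbTE Hs) parent_pr.
by rewrite /colour -!/(limit_of colour_step _) -(limit_step colour_step_lt) E.
Qed.

Lemma switched_ev m j : switching m ->
  switched m j = (0 < ev (fun_index m) (pr m 0) j) &&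
    ~~ reach (ev (fun_index m) (pr m 0) j).-1 (pr m 0).
Proof. by rewrite /switched => ->. Qed.

(** No computation converges in zero steps, so the first element of a positive chain always has the
    colour of its target. *)
Lemma switched0 m : switched m 0 = false.
Proof. by rewrite /switched andbF. Qed.

(** * Merging *)

(* The history [H] of the construction is the list of the stages at which a merge
   took place; stage [s] merges the chain [p1 s]. *)
Definition merged H m := has (fun h => mem_code H h && (p1 h == m)) (iota 0 H).

Lemma mergedP H m : reflect (exists2 h, mem_code H h & p1 h = m) (merged H m).
Proof.
apply: (iffP hasP) => [[h _ /andP[? /eqP]]|[h Hh Hm]]; exists h => //.
  by rewrite mem_iota /= add0n mem_code_lt.
by rewrite Hh Hm eqxx.
Qed.

Definition nf_step H x := if merged H (p1 x) then parent x else x.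
Definition nf H x := iter (p1 x) (nf_step H) x.

Lemma nf_step_lt H x : nf_step H x = x \/ p1 (nf_step H x) < p1 x.
Proof.
rewrite /nf_step; case: ifP => _; last by left.
by case: (posnP (p1 x)) => [E|x0]; [left; rewrite /parent E | right; apply: parent_lt].
Qed.

Lemma nf_merged H x : merged H (p1 x) -> nf H x = nf H (parent x).
Proof.
by move=> E; rewrite /nf -!/(limit_of _ _) -(limit_step (@nf_step_lt H)) /nf_step E.
Qed.

Lemma nf_root H x : ~~ merged H (p1 x) -> nf H x = x.
Proof. by move=> E; rewrite /nf -/(limit_of _ _) limit_id // /nf_step (negbTE E). Qed.

Lemma nf_chain0 H x : p1 x = 0 -> nf H x = x.
Proof. by rewrite /nf => ->. Qed.

Lemma nf_ind H (P : nat -> nat -> Prop) :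
  (forall x, p1 x = 0 \/ ~~ merged H (p1 x) -> P x x) ->
  (forall x, 0 < p1 x -> merged H (p1 x) ->
     P (parent x) (nf H (parent x)) -> P x (nf H (parent x))) ->
  forall x, P x (nf H x).
Proof.
move=> P0 PS x; have [n] := ubnP (p1 x); elim: n x => // n IH x Hx.
case: (posnP (p1 x)) => [E|x0]; first by rewrite nf_chain0 //; apply: P0; left.
case: (boolP (merged H (p1 x))) => Hm; last by rewrite nf_root //; apply: P0; right.
rewrite nf_merged //; apply: PS => //; apply: IH.
by have := parent_lt x0; lia.
Qed.

Lemma nf_nf H x : p1 (nf H x) = 0 \/ ~~ merged H (p1 (nf H x)).
Proof. by elim/(nf_ind (H := H)): x / (nf H x). Qed.

Lemma nf_le H x : p1 (nf H x) <= p1 x.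
Proof.
elim/(nf_ind (H := H)): x / (nf H x) => // x x0 _.
by move=> /leq_trans; apply; apply: parent_le.
Qed.

Lemma nf_path H x : exists k, nf H x = iter k parent x.
Proof.
elim/(nf_ind (H := H)): x / (nf H x) => [x _|x _ _ [k ->]]; first by exists 0.
by exists k.+1; rewrite iterSr.
Qed.

Lemma nf_shift H k x : nf H (shift k x) = shift k (nf H x).
Proof.
elim/(nf_ind (H := H)): x / (nf H x) => [x [E|Hm]|x _ Hm IH].
- by rewrite nf_chain0 ?p1_shift.
- by rewrite nf_root ?p1_shift.
- by rewrite nf_merged ?p1_shift // parent_shift IH.
Qed.

Lemma nf_sub H H' x :
  (forall m, merged H m -> merged H' m) -> nf H' (nf H x) = nf H' x.
Proof.
move=> S; elim/(nf_ind (H := H)): x / (nf H x) => // x _ Hm IH.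
by rewrite [RHS]nf_merged //; apply: S.
Qed.

(** The walk from [x] only meets chains of index at most [p1 x]. *)
Lemma nf_local H H' x :
  (forall m, m <= p1 x -> merged H m = merged H' m) -> nf H x = nf H' x.
Proof.
have [n] := ubnP (p1 x); elim: n x => // n IH x Hx L.
case: (posnP (p1 x)) => [E|x0]; first by rewrite !nf_chain0.
case: (boolP (merged H (p1 x))) => Hm.
  have Hm' : merged H' (p1 x) by rewrite -L.
  rewrite (nf_merged Hm) (nf_merged Hm'); have lt := parent_lt x0.
  by apply: IH => [|m Hle]; [lia | apply: L; lia].
by rewrite !nf_root // -L.
Qed.

(** * The stages of the construction *)

Definition side_rel_at H (b : bool) u v :=
  if colour u == b then (colour v == b) && (nf H u == nf H v) else colour v != b.

(* The restraint: [m] must be younger than every earlier action [t] of the same or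
   higher priority, and the last action of its own requirement, if any, must have
   been injured since. *)
Definition permitted H m :=
  all (fun t => ~~ (mem_code H t && (req (p1 t) <= req m)) ||
    ((t <= m) && ((req (p1 t) != req m) ||
      has (fun u => [&& mem_code H u, t < u & req (p1 u) < req m]) (iota 0 H)))) (iota 0 H).

Lemma permittedP H m : reflect
  (forall t, mem_code H t -> req (p1 t) <= req m -> t <= m /\
     (req (p1 t) = req m -> exists u, [/\ mem_code H u, t < u & req (p1 u) < req m]))
  (permitted H m).
Proof.
apply: (iffP allP) => A t.
  move=> Ht Hr; have := A t; rewrite mem_iota /= add0n mem_code_lt // Ht Hr /=.
  case/(_ isT)/andP=> -> E; split=> // Er; move: E; rewrite Er eqxx /=.
  by move=> /hasP[u _ /and3P[? ? ?]]; exists u.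
move=> _; case: (boolP (mem_code H t && _)) => //= /andP[Ht Hr].
have [-> E] := A t Ht Hr; case: eqP => //= /E[u [Hu tu Ru]].
by apply/hasP; exists u; rewrite ?Hu ?tu // mem_iota /= add0n mem_code_lt.
Qed.

(** The last test uses the history that already contains the new merge: the chain is to be
    identified with its target while the two images stay inequivalent. Both values must be below
    [s], so that the restraint imposed at stage [s] protects the chains they lie in. *)
Definition may_act H s :=
  [&& 0 < p1 s, p1 s < s, permitted H (p1 s),
   colour (pr (target (p1 s)) (offset (p1 s))) == side (p1 s),
   (0 < ev (fun_index (p1 s)) (pr (p1 s) 0) s) && (ev (fun_index (p1 s)) (pr (p1 s) 0) s <= s),
   (0 < ev (fun_index (p1 s)) (pr (target (p1 s)) (offset (p1 s))) s) &&
     (ev (fun_index (p1 s)) (pr (target (p1 s)) (offset (p1 s))) s <= s),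
   ~~ (switching (p1 s) && ~~ reach (ev (fun_index (p1 s)) (pr (p1 s) 0) s).-1 (pr (p1 s) 0)) &
   ~~ side_rel_at (cons_code s H) (side (p1 s)) (ev (fun_index (p1 s)) (pr (p1 s) 0) s).-1
       (ev (fun_index (p1 s)) (pr (target (p1 s)) (offset (p1 s))) s).-1].

Definition history s :=
  nat_rect (fun=> nat) 0 (fun i H => if may_act H i then cons_code i H else H) s.

Definition acts s := may_act (history s) s.

Lemma history_mem s t : mem_code (history s) t = (t < s) && acts t.
Proof.
elim: s => // s IH; rewrite /= -/(acts s) ltnS leq_eqVlt andb_orl -IH.
case: (eqVneq t s) => [->|ts]; case: ifP => E; rewrite ?mem_code_cons ?eqxx ?E //=.
by rewrite eq_sym (negbTE ts).
Qed.

Lemma history_merged s m : reflect (exists t, [/\ t < s, acts t & p1 t = m]) (merged (history s) m).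
Proof.
apply: (iffP (mergedP _ _)) => [[t]|[t [ts at_ E]]].
  by rewrite history_mem => /andP[? ?] ?; exists t.
by exists t; rewrite // history_mem ts.
Qed.

Lemma history_merged_mono s t m : s <= t -> merged (history s) m -> merged (history t) m.
Proof.
move=> st /history_merged[u [us au E]]; apply/history_merged; exists u; split=> //; lia.
Qed.

(** The values of [ev] found by stage [s] and by stage [j] agree, and acting at [s] excludes
    switching on that value. So a merged chain copies the colours of its target everywhere, and
    merges preserve colour. *)
Lemma acts_switched s j : acts s -> switched (p1 s) j = false.
Proof.
case/and5P=> m0 _ _ _ /and4P[/andP[E _] _ K _].
apply/negbTE; apply: contra K => /and3P[-> H /=].
case E1 : (ev _ _ s) E => [//|y] _; case E2 : (ev _ _ j) H => [//|z] _.
have := ev_mono (leq_maxl s j) E1; rewrite (ev_mono (leq_maxr s j) E2).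
by case=> ->.
Qed.

Lemma colour_nf s x : colour (nf (history s) x) = colour x.
Proof.
elim/(nf_ind (H := history s)): x / (nf _ x) => // x x0 Hm ->.
rewrite -[in RHS](pr_p x) colour_parent //; first by rewrite /parent eqn0Ngt x0.
by case/history_merged: Hm => t [_ At <-]; rewrite acts_switched.
Qed.

Lemma nf_history s t x : s <= t -> nf (history t) (nf (history s) x) = nf (history t) x.
Proof. by move=> st; apply: nf_sub => m; apply: history_merged_mono. Qed.

Lemma nf_history_eq s t x y : s <= t ->
  nf (history s) x = nf (history s) y -> nf (history t) x = nf (history t) y.
Proof. by move=> st E; rewrite -(nf_history x st) E nf_history. Qed.

(** * The limit relation and its two sides *)

Definition ident x y := exists s, nf (history s) x = nf (history s) y.

Lemma ident_refl x : ident x x. Proof. by exists 0. Qed.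
Lemma ident_sym x y : ident x y -> ident y x. Proof. by case=> s; exists s. Qed.
Lemma ident_trans x y z : ident x y -> ident y z -> ident x z.
Proof.
move=> [s Hs] [t Ht]; exists (maxn s t).
by rewrite (nf_history_eq (leq_maxl s t) Hs) (nf_history_eq (leq_maxr s t) Ht).
Qed.

Lemma ident_colour x y : ident x y -> colour x = colour y.
Proof. by case=> s E; rewrite -(colour_nf s) E colour_nf. Qed.

Lemma ident_shift k x y : ident (shift k x) (shift k y) <-> ident x y.
Proof.
split=> -[s E]; exists s; last by rewrite !nf_shift E.
by apply: (@shift_inj k); rewrite -!nf_shift.
Qed.

Lemma ident_shift_inj k l x : ident (shift k x) (shift l x) -> k = l.
Proof. by case=> s; rewrite !nf_shift => /shift_injl. Qed.

(* The elements of the wrong colour form a single junk class. *)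
Definition side_rel b u v :=
  (colour u = b /\ colour v = b /\ ident u v) \/ (colour u <> b /\ colour v <> b).

Lemma side_relE b u v : side_rel b u v <-> exists s, side_rel_at (history s) b u v.
Proof.
rewrite /side_rel_at; split.
  case=> [[E1 [E2 [s E3]]]|[/eqP/negbTE -> /eqP ->]]; last by exists 0.
  by exists s; rewrite E1 E2 E3 !eqxx.
case=> s; case: eqP => [E /andP[/eqP Ev /eqP N]|E /eqP Ev]; [left|by right].
by split=> //; split=> //; exists s.
Qed.

Lemma side_rel_equiv b : Equivalence (side_rel b).
Proof.
split.
- move=> x; case: (colour x =P b) => E; [left|by right].
  by do 2!split=> //; apply: ident_refl.
- by move=> x y [[? [? /ident_sym]]|[]]; [left|right].
- move=> x y z [[xb [yb xy]]|[xb yb]] [[yb' [zb yz]]|[yb' zb]] //; [left|by right].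
  by do 2!split=> //; apply: ident_trans xy yz.
Qed.


(** * Computability of the construction *)

Lemma rec_parent n a : Rec n a -> Rec n (fun xs => parent (a xs)).
Proof. by apply: (@rec_app1 parent); rewrite /Rec1 /parent /target /offset; auto 20 with rec. Qed.
#[local] Hint Resolve rec_parent : rec.

Lemma rec_reach n a b : Rec n a -> Rec n b -> Rec n (fun xs => reach (a xs) (b xs)).
Proof. by apply: (@rec_app2 reach); rewrite /Rec2 /reach; auto 20 with rec. Qed.
#[local] Hint Resolve rec_reach : rec.

Lemma rec_switched n a b : Rec n a -> Rec n b -> Rec n (fun xs => switched (a xs) (b xs)).
Proof.
by apply: (@rec_app2 switched); rewrite /Rec2 /switched /switching /fun_index /req;
  auto 20 with rec.
Qed.
#[local] Hint Resolve rec_switched : rec.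

Lemma rec_colour n a : Rec n a -> Rec n (fun xs => colour (a xs)).
Proof.
by apply: (@rec_app1 colour); rewrite /Rec1 /colour /colour_step /side /req; auto 30 with rec.
Qed.
#[local] Hint Resolve rec_colour : rec.

Lemma rec_merged n a b : Rec n a -> Rec n b -> Rec n (fun xs => merged (a xs) (b xs)).
Proof. by apply: (@rec_app2 merged); rewrite /Rec2 /merged; auto 20 with rec. Qed.
#[local] Hint Resolve rec_merged : rec.

Lemma rec_nf n a b : Rec n a -> Rec n b -> Rec n (fun xs => nf (a xs) (b xs)).
Proof. by apply: (@rec_app2 nf); rewrite /Rec2 /nf /nf_step; auto 20 with rec. Qed.
#[local] Hint Resolve rec_nf : rec.

Lemma rec_side_rel_at n a (b : seq nat -> bool) c d : Rec n a -> Rec n b -> Rec n c -> Rec n d ->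
  Rec n (fun xs => side_rel_at (a xs) (b xs) (c xs) (d xs)).
Proof. by move=> *; rewrite /side_rel_at; auto 20 with rec. Qed.
#[local] Hint Resolve rec_side_rel_at : rec.

Lemma rec_permitted n a b : Rec n a -> Rec n b -> Rec n (fun xs => permitted (a xs) (b xs)).
Proof. by apply: (@rec_app2 permitted); rewrite /Rec2 /permitted /req; auto 30 with rec. Qed.
#[local] Hint Resolve rec_permitted : rec.

Lemma rec_may_act n a b : Rec n a -> Rec n b -> Rec n (fun xs => may_act (a xs) (b xs)).
Proof.
by apply: (@rec_app2 may_act);
  rewrite /Rec2 /may_act /side /switching /fun_index /target /offset /req;
  auto 30 with rec.
Qed.
#[local] Hint Resolve rec_may_act : rec.

Lemma rec_history n a : Rec n a -> Rec n (fun xs => history (a xs)).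
Proof. by apply: (@rec_app1 history); rewrite /Rec1 /history; auto 20 with rec. Qed.
#[local] Hint Resolve rec_history : rec.

Lemma side_rel_ceer b : ceer (side_rel b).
Proof.
split; first exact: side_rel_equiv.
apply: (@rec_comp_enum _ (fun s u v => side_rel_at (history s) b u v)); last exact: side_relE.
by rewrite /Rec3; auto with rec.
Qed.

(** * The priority argument *)

Lemma actsE s (m := p1 s) : acts s ->
  [/\ 0 < m, m < s, permitted (history s) m & colour (pr (target m) (offset m)) = side m].
Proof. by case/and5P=> ? ? ? /eqP ? _. Qed.

(** Once all requirements below [r] are silent, [r] can act only once more: a second action would
    need an injury in between. *)
Lemma finitely_many_acts r :
  exists s0, forall s, s0 <= s -> acts s -> r <= req (p1 s).
Proof.
elim: r => [|r [s0 IH]]; first by exists 0.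
case: (classic (exists2 s1, s0 <= s1 & acts s1 /\ req (p1 s1) = r)).
  move=> [s1 s01 [A1 R1]]; exists s1.+1 => s lt A.
  have := IH s (leq_trans (leqW s01) lt) A; rewrite leq_eqVlt => /orP[/eqP E|//].
  have [_ _ /permittedP P _] := actsE A.
  have M : mem_code (history s) s1 by rewrite history_mem lt.
  have := P s1 M; rewrite R1 -E leqnn => -[//|_ /(_ erefl)[u []]].
  by rewrite history_mem => /andP[_ Au] s1u; have := IH u (ltnW (leq_ltn_trans s01 s1u)) Au; lia.
move=> N; exists s0 => s lt A; have := IH s lt A; rewrite leq_eqVlt => /orP[/eqP E|//].
by case: N; exists s.
Qed.

(** Later actions have lower priority, and the restraint confines them to chains of index at least
    [s]. *)
Lemma acts_preserved s t m : acts s -> s < t ->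
  (forall u, s < u -> acts u -> req (p1 s) < req (p1 u)) ->
  m < s -> merged (history t) m = merged (history s.+1) m.
Proof.
move=> A st N ms; apply/idP/idP; last exact: history_merged_mono.
case/history_merged=> u [ut Au E]; apply/history_merged; exists u; split=> //.
rewrite ltnNge; apply/negP => su; have [_ _ /permittedP P _] := actsE Au.
have M : mem_code (history u) s by rewrite history_mem su.
by have [] := P s M (ltnW (N u su Au)); lia.
Qed.

(** * Reductions of one side to itself *)

Section Reduction.
Variables (b : bool) (f : nat -> nat) (e : nat).
Hypothesis f_red : forall x y, side_rel b x y <-> side_rel b (f x) (f y).
Hypothesis f_idx : forall x, exists s, ev e x s = (f x).+1.

Lemma ev_f x s : 0 < ev e x s -> ev e x s = (f x).+1.
Proof.
case E : (ev e x s) => [//|y] _; have [t Ht] := f_idx x.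
by have := ev_mono (leq_maxl s t) E; rewrite (ev_mono (leq_maxr s t) Ht).
Qed.

(** Without such a [u] the action would succeed for good: the first element of the chain is
    identified with its target, while the images lie in chains below [s], where no further merge
    occurs. This contradicts [f_red]. *)
Lemma win_injured s : acts s -> req (p1 s) = pr e b ->
  exists u, [/\ s < u, acts u & req (p1 u) <= req (p1 s)].
Proof.
move=> A R; apply: NNPP => N.
have {}N u : s < u -> acts u -> req (p1 s) < req (p1 u).
  by move=> su Au; rewrite ltnNge; apply/negP => le; apply: N; exists u.
have [m0 ms _ c] := actsE A; set m := p1 s in R m0 ms c.
have sdm : side m = b by rewrite /side R p2_pr eqb1.
have idm : fun_index m = e by rewrite /fun_index R p1_pr.
case/and5P: (A) => _ _ _ _ /and4P[]; rewrite -/m sdm idm.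
move=> /andP[/ev_f -> ys] /andP[/ev_f -> zs] _; rewrite ![_.+1.-1]/=.
set y := f _ in ys *; set z := f _ in zs * => /negP; apply.
have Hm : merged (history s.+1) m by apply/history_merged; exists s.
have cm : colour (pr m 0) = b.
  by rewrite colour_parent ?acts_switched // addn0 c.
have Hyz : side_rel b y z.
  apply: (proj1 (f_red _ _)); left; rewrite cm c sdm; do 2!split=> //; exists s.+1.
  by rewrite nf_merged ?p1_pr // parent_pr // addn0.
have E : history s.+1 = cons_code s (history s) by rewrite /= -/(acts s) A.
rewrite -E /side_rel_at; case: Hyz => [[-> [-> [t Ht]]]|[/eqP/negbTE -> /eqP -> //]].
rewrite !eqxx /=; have := nf_history_eq (leq_maxl t s.+1) Ht.
have L x : x < s -> nf (history (maxn t s.+1)) x = nf (history s.+1) x.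
  move=> xs; apply: nf_local => k kx; apply: acts_preserved => //.
    by rewrite leq_max ltnSn orbT.
  by apply: leq_ltn_trans kx (leq_ltn_trans (p1_le x) xs).
by rewrite !L // => ->.
Qed.

(** [s0] lies beyond all actions of priority up to that of [pr e b]. Each earlier action of this
    requirement has been injured, so no restraint stops its chains beyond [s0]. *)
Lemma eventually_permitted : exists s0,
  (forall s, s0 <= s -> acts s -> req (p1 s) <> pr e b) /\
  (forall s m, s0 <= m -> req m = pr e b -> s0 <= s -> permitted (history s) m).
Proof.
have [s0 Hs0] := finitely_many_acts (pr e b).+1; exists s0.
split=> [s ss As E|s m sm R ss]; first by have := Hs0 s ss As; rewrite E ltnn.
have small t : acts t -> req (p1 t) <= pr e b -> t < s0.
  by move=> At le; rewrite ltnNge; apply/negP => /Hs0/(_ At); lia.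
(* The action following [t] may belong to the same requirement; the question then moves to that
   later stage, still below [s0]. *)
have inj d t : s0 - t <= d -> acts t -> req (p1 t) = pr e b ->
    exists u, [/\ acts u, t < u & req (p1 u) < pr e b].
  elim: d t => [|d IH] t Hd At Rt.
    by have := small t At; rewrite Rt leqnn => /(_ isT); lia.
  have [u [tu Au]] := win_injured At Rt; rewrite Rt leq_eqVlt => /orP[/eqP Ru|lt].
    have := small u Au; rewrite Ru leqnn => /(_ isT) us.
    have [|v [Av uv Rv]] := IH u _ Au Ru; first by lia.
    by exists v; split=> //; lia.
  by exists u.
apply/permittedP => t; rewrite history_mem => /andP[ts At]; rewrite R => Rt.
have t0 := small t At Rt; split=> [|E]; first by lia.
have [u [Au tu Ru]] := inj _ t (leqnn _) At E; exists u; split=> //.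
by rewrite history_mem Au (leq_trans (small u Au (ltnW Ru)) ss).
Qed.

(** The chain is permitted at all late stages and yet never acts. At a stage where both computations
    have converged, only the last test of [may_act] can be what fails. *)
Lemma settled_chain : exists s0, forall m, s0 <= m -> req m = pr e b ->
  (forall s, ~~ merged (history s) m) /\
  (colour (pr (target m) (offset m)) = b -> 0 < m ->
   ~~ (switching m && ~~ reach (f (pr m 0)) (pr m 0)) ->
   exists s, side_rel_at (cons_code s (history s)) b
                (f (pr m 0)) (f (pr (target m) (offset m))) /\ p1 s = m).
Proof.
have [s0 [H1 H2]] := eventually_permitted; exists s0 => m sm R; split.
  move=> s; apply/negP => /history_merged[t [ts At E]].
  have [_ mt _ _] := actsE At; apply: (H1 t _ At); last by rewrite E.
  by rewrite E in mt; lia.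
move=> c m0 K.
have idm : fun_index m = e by rewrite /fun_index R p1_pr.
have sdm : side m = b by rewrite /side R p2_pr eqb1.
have [s1 E1] := f_idx (pr m 0); have [s2 E2] := f_idx (pr (target m) (offset m)).
(* Stage [pr m k] is devoted to chain [m] and exceeds [s0], [m], both convergence times and both
   values. *)
set k := s0 + m + s1 + s2 + f (pr m 0) + f (pr (target m) (offset m)) + 1.
have [_ ks] := andP (pr_ge m k); exists (pr m k); set s := pr m k in ks *.
have ps : p1 s = m by apply: p1_pr.
split=> //; have ss0 : s0 <= s by lia.
apply: NNPP => N; apply: (H1 s ss0); last by rewrite ps.
have e1 : ev e (pr m 0) s = (f (pr m 0)).+1 by apply: ev_mono E1; lia.
have e2 : ev e (pr (target m) (offset m)) s = (f (pr (target m) (offset m))).+1.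
  by apply: ev_mono E2; lia.
rewrite /acts /may_act ps idm sdm m0 (H2 s m sm R ss0) c eqxx e1 e2 K /=.
by apply/and4P; split; [lia|lia|lia|apply/negP => Q; apply: N].
Qed.

(** As [m] is never merged, its first element and its target are inequivalent, and so are their
    images. Merging [m] would nevertheless identify the images, so one of them has its normal form
    in chain [m]. *)
Lemma merge_cases : exists s0, forall m, s0 <= m -> req m = pr e b -> 0 < m ->
  colour (pr (target m) (offset m)) = b ->
  ~~ (switching m && ~~ reach (f (pr m 0)) (pr m 0)) ->
  [/\ colour (f (pr m 0)) = b, colour (f (pr (target m) (offset m))) = b &
   exists j, (ident (f (pr m 0)) (pr m j) /\
              ident (f (pr (target m) (offset m))) (pr (target m) (offset m + j))) \/
             ident (f (pr (target m) (offset m))) (pr m j)].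
Proof.
have [s0 H0] := settled_chain; exists s0 => m sm R m0 c K.
have [root /(_ c m0 K)[s [Hs ps]]] := H0 m sm R.
set y := f _ in Hs *; set z := f _ in Hs *.
have notX : ~ side_rel b y z.
  move=> /(proj2 (f_red _ _)) [[_ [_ [t]]]|[_ /(_ c) //]].
  rewrite nf_root ?p1_pr // => E; have := nf_le (history t) (pr (target m) (offset m)).
  by rewrite -E !p1_pr leqNgt target_lt.
have [cy [cz Ez]] : [/\ colour y = b, colour z = b &
    nf (cons_code s (history s)) y = nf (cons_code s (history s)) z].
  move: Hs; rewrite /side_rel_at; case: eqP => [-> /andP[/eqP -> /eqP] //|cy /eqP cz].
  by case: notX; right.
split=> //; set H := cons_code _ _ in Ez.
have HM k : merged H k = merged (history s) k || (k == m).
  apply/mergedP/orP => [[h]|[/mergedP[h Hh E]|/eqP ->]].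
  - rewrite mem_code_cons => /orP[/eqP <- <-|Hh E]; first by right; rewrite ps.
    by left; apply/mergedP; exists h.
  - by exists h; rewrite // mem_code_cons Hh orbT.
  - by exists s; rewrite // mem_code_cons eqxx.
have sub k : merged (history s) k -> merged H k by rewrite HM => ->.
have ptrm j : nf H (pr m j) = nf (history s) (pr (target m) (offset m + j)).
  rewrite nf_merged ?p1_pr ?HM ?eqxx ?orbT // parent_pr //; apply: nf_local => k.
  rewrite p1_pr HM => km; case: eqP => [E|]; last by rewrite orbF.
  by have := target_lt m0; lia.
have other x : p1 (nf (history s) x) <> m -> nf H (nf (history s) x) = nf (history s) x.
  move=> /eqP Hx; case: (nf_nf (history s) x) => [E|E]; first by rewrite nf_chain0.
  by rewrite nf_root // HM negb_or E.
have this x : p1 (nf (history s) x) = m -> exists2 j, nf (history s) x = pr m j &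
    nf H (nf (history s) x) = nf (history s) (pr (target m) (offset m + j)).
  move=> E; have Ex : nf (history s) x = pr m (p2 (nf (history s) x)) by rewrite -E pr_p.
  by exists (p2 (nf (history s) x)); rewrite // [in LHS]Ex ptrm.
have nfm j : nf (history s) (pr m j) = pr m j by rewrite nf_root ?p1_pr.
rewrite -(nf_sub y sub) -(nf_sub z sub) in Ez.
case: (p1 (nf (history s) z) =P m) => [/this[j Ej Hj]|/other Oz].
  by exists j; right; exists s; rewrite nfm.
case: (p1 (nf (history s) y) =P m) => [/this[j Ej Hj]|/other Oy].
  exists j; left; split; exists s; first by rewrite nfm.
  by rewrite -Hj Ez Oz.
by case: notX; left; do 2!split=> //; exists s; rewrite -Oy -Oz.
Qed.

(** Normal forms never raise the chain index; this will exclude values fixed before [m] was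
    chosen. *)
Lemma ident_root m x j : (forall s, ~~ merged (history s) m) -> ident x (pr m j) ->
  m <= p1 x /\ exists s, nf (history s) x = pr m j.
Proof.
move=> root [s]; rewrite [RHS]nf_root ?p1_pr // => Hs; split; last by exists s.
by have := nf_le (history s) x; rewrite Hs p1_pr.
Qed.

Lemma forward n i : colour (pr n i) = b ->
  colour (f (pr n i)) = b /\ exists j, ident (f (pr n i)) (pr n (i + j)).
Proof.
move=> c; have [s0 H0] := settled_chain; have [s1 H1] := merge_cases.
(* The padding puts [m] beyond the thresholds and beyond [f (pr n i)], which therefore cannot be
   identified with an element of chain [m]. *)
set m := mk_chain e b n i false (s0 + s1 + f (pr n i)).
have := mk_chain_gt e b n i false (s0 + s1 + f (pr n i)); rewrite -/m => Hm.
have [R _ _ [T O K]] := mk_chainE e b n i false (s0 + s1 + f (pr n i)).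
rewrite -/m in R T O K.
have m1 : s1 <= m by lia.
have m0 : 0 < m by lia.
have := H1 m m1 R m0; rewrite T O K => /(_ c isT)[_ cz [j [[_ Hz]|Hz]]].
  by split=> //; exists j.
have [|root _] := H0 m _ R; first by lia.
by have [+ _] := ident_root root Hz; have := p1_le (f (pr n i)); lia.
Qed.

Lemma ident_reflect x y : colour x = b -> ident (f x) (f y) -> colour (f x) = b -> ident x y.
Proof.
move=> cx Hz cf; have /(proj2 (f_red _ _)) : side_rel b (f x) (f y).
  by left; rewrite -(ident_colour Hz) cf.
by case=> [[_ [_ //]]|[/(_ cx)]].
Qed.

(** Descending induction on [j]: if [f] moved [pr m j] to a later element of the chain, that element
    would already be fixed, and two inequivalent elements would have equivalent images. *)
Lemma finite_chain_fixed m t j : (forall k, t <= k -> colour (pr m k) <> b) ->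
  colour (pr m j) = b -> ident (f (pr m j)) (pr m j).
Proof.
move=> Ht; have [d] := ubnP (t - j); elim: d j => // d IH j Hd c.
have [cf [k Hk]] := forward c; case: (posnP k) => [k0|k0].
  by move: Hk; rewrite k0 addn0.
have ck : colour (pr m (j + k)) = b by rewrite -(ident_colour Hk).
have lt : j < t by rewrite ltnNge; apply/negP => /Ht.
have Hjk : t - (j + k) < d by lia.
have := ident_reflect c (ident_trans Hk (ident_sym (IH _ Hjk ck))) cf.
rewrite -{1}[j]addn0 -!shift_pr => /ident_shift_inj; lia.
Qed.

Lemma f_id x : colour x = b -> ident (f x) x.
Proof.
rewrite -(pr_p x); move: (p1 x) (p2 x) => n i c {x}.
have [s0 H0] := settled_chain; have [s1 H1] := merge_cases.
set m := mk_chain e b n i true (s0 + s1 + f (pr n i)).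
have := mk_chain_gt e b n i true (s0 + s1 + f (pr n i)); rewrite -/m => Hm.
have [R I S [T O K]] := mk_chainE e b n i true (s0 + s1 + f (pr n i)).
rewrite -/m in R I S T O K.
have [|root _] := H0 m _ R; first by lia.
have m0 : 0 < m by lia.
case: (boolP (reach (f (pr m 0)) (pr m 0))) => Hr.
  have m1 : s1 <= m by lia.
  have := H1 m m1 R m0; rewrite T O K Hr => /(_ c isT)[cy cz [j [[Hy Hz]|Hz]]].
    (* The parent path of [f (pr m 0)] passes through [pr m 0] and meets chain [m] only once, so [j]
       is 0. *)
    have [_ [s Es]] := ident_root root Hy; have [k Ek] := nf_path (history s) (f (pr m 0)).
    have /(reachP _ _ m0)[l El] := Hr; rewrite Es in Ek.
    have : k = l by apply: (@parent_path_inj _ _ (f (pr m 0))); rewrite -Ek ?El !p1_pr.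
    move=> E; move: Ek; rewrite E El => /(congr1 p2); rewrite !p2_pr => j0.
    by move: Hz; rewrite j0 addn0.
  by have [+ _] := ident_root root Hz; have := p1_le (f (pr n i)); lia.
(* Here the chain switches from position [t] on, while [pr m 0] keeps colour [b]. Hence [f] fixes
   the class of [pr m 0], and [f (pr m 0)] reaches [pr m 0] after all. *)
have [t Ht] := f_idx (pr m 0).
have Hsw k : t <= k -> colour (pr m k) <> b.
  move=> tk; rewrite colour_switched ?S; first by case: (b).
    exact: m0.
  by rewrite switched_ev // I (ev_mono tk Ht).
have c0 : colour (pr m 0) = b by rewrite colour_parent ?switched0 // T O addn0.
have [_ [s Es]] := ident_root root (finite_chain_fixed Hsw c0).
have [k Ek] := nf_path (history s) (f (pr m 0)).
by case/negP: Hr; apply/reachP => //; exists k; rewrite -Ek.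
Qed.
End Reduction.

Lemma side_rel_self_full b : self_full (side_rel b).
Proof.
move=> f [/computable_index[e He] Hf] y.
exists y; case: (colour y =P b) => cy.
  have H := f_id Hf He cy; by left; rewrite (ident_colour H).
(* The junk class must map to itself: if [f y] had colour [b], then [f] would fix it, so [f y] and
   [y] would have equivalent images, although [y] is junk. *)
right; split=> // cf; have H := f_id Hf He cf.
have /(proj2 (Hf _ _)) : side_rel b (f (f y)) (f y) by left; rewrite (ident_colour H).
by case=> [[_ [/cy]]|[/(_ cf)]].
Qed.

(** * The uniform join *)

Lemma rec_half n a : Rec n a -> Rec n (fun xs => (a xs)./2).
Proof.
apply: (@rec_app1 half).
have: Rec1 (fun u => find (fun x => u < x.+1 + x.+1) (iota 0 u.+1)).
  by rewrite /Rec1; auto 20 with rec.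
apply: rec_ext => xs; apply: find_iota; [lia|lia|].
by move=> i Hi; rewrite -leqNgt; lia.
Qed.
#[local] Hint Resolve rec_half : rec.

Lemma rec_odd n a : Rec n a -> Rec n (fun xs => odd (a xs)).
Proof.
move=> Ha; have: Rec n (fun xs => a xs != (a xs)./2 + (a xs)./2) by auto 20 with rec.
by apply: rec_ext => xs; congr nat_of_bool; lia.
Qed.
#[local] Hint Resolve rec_odd : rec.

(* [u] does not lie in the junk class of its side. *)
Definition active u := colour u./2 == ~~ odd u.

Lemma uniform_joinE u v :
  uniform_join (side_rel true) (side_rel false) u v <->
  odd u = odd v /\ side_rel (~~ odd u) u./2 v./2.
Proof.
split.
  case=> -[x [y [-> -> H]]]; rewrite ?mul2n ?addn1 /= ?odd_double /=.
    by rewrite !doubleK.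
  by rewrite !uphalf_double.
move=> [E H]; case Hu : (odd u) H => H.
  right; exists u./2, v./2; split=> //; [|rewrite E in Hu]; lia.
left; exists u./2, v./2; split=> //; [|rewrite E in Hu]; lia.
Qed.

(** On active elements the colour determines the side, so the two active parts together form a copy
    of [ident]; parity matters only for telling the two junk classes apart. *)
Lemma uniform_join_active u v :
  uniform_join (side_rel true) (side_rel false) u v <->
  active u = active v /\ if active u then ident u./2 v./2 else odd u = odd v.
Proof.
rewrite uniform_joinE /active; split.
  case=> E [[cu [cv H]]|[/eqP/negbTE nu /eqP/negbTE nv]].
    by rewrite -E cu cv eqxx.
  by rewrite -E nu nv.
case: eqP => [cu [/esym/eqP cv H]|nu [/esym/eqP nv E]].
  have E : odd u = odd v by have := ident_colour H; rewrite cu cv; case: odd; case: odd.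
  by split=> //; left; rewrite cu E cv.
by split=> //; right; split=> //; rewrite E.
Qed.

(** The parity of the result is chosen by the colour of the shifted element, which makes the result
    active again. *)
Definition shift_join u :=
  if active u then (shift 1 u./2 + shift 1 u./2) + ~~ colour (shift 1 u./2) else u.

Lemma shift_join_active u : active u ->
  active (shift_join u) /\ (shift_join u)./2 = shift 1 u./2.
Proof.
move=> A; have E : (shift_join u)./2 = shift 1 u./2.
  by rewrite /shift_join A; case: (colour _); lia.
split=> //; rewrite /active E /shift_join A; move: (shift 1 _) => x.
by case: (colour x) => /=; lia.
Qed.

Lemma shift_join_reduction :
  reduction (uniform_join (side_rel true) (side_rel false))
    (uniform_join (side_rel true) (side_rel false)) shift_join.
Proof.
split.
  apply: rec_computable; rewrite /Rec1 /shift_join /active /shift.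
  by auto 30 with rec.
move=> u v; rewrite !uniform_join_active.
have P w : active (shift_join w) = active w.
  case A : (active w); first by have [] := shift_join_active A.
  by rewrite /shift_join A.
rewrite !P; case Au : (active u); case Av : (active v); try by split=> -[].
  have [_ ->] := shift_join_active Au; have [_ ->] := shift_join_active Av.
  by split=> -[_ /ident_shift H].
by rewrite /shift_join Au Av.
Qed.

Theorem mainTheorem1 :
  exists X Y : nat -> nat -> Prop,
    (ceer X /\ self_full X) /\ (ceer Y /\ self_full Y) /\
    ~ self_full (uniform_join X Y).
Proof.
exists (side_rel true), (side_rel false).
do 2!(split; first by split; [exact: side_rel_ceer | exact: side_rel_self_full]).
(* The class of 0, which stands for the element [pr 0 0] on the side [true], is missed: a preimage
   would be active, and the normal form of its shift has a positive second component. *)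
move=> /(_ _ shift_join_reduction 0)[u /uniform_join_active].
have p0 : p1 0 = 0 /\ p2 0 = 0 by rewrite -[0]/(pr 0 0).
have A0 : active 0 by rewrite /active /= colour_chain0 //; case: p0.
rewrite A0 => -[A]; rewrite A => -[s].
have Au : active u by case E : (active u) A => //; rewrite /shift_join E E.
have [_ ->] := shift_join_active Au; case: p0 => p10 p20; rewrite nf_shift [in RHS]nf_chain0 //.
by move=> /(congr1 p2); rewrite p2_shift [in RHS]p20; lia.
Qed.
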